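(* The face lattice of $ASM_n$ is isomorphic to the lattice of all elementary flow grids of order $n$ (including the empty grid, corresponding to the empty face) ordered by inclusion of edge sets. Explicitly, the map sending a face $F$ to $g(F)=\bigcup_{A\text{ a vertex of }F} g(A)$ is an inclusion-preserving bijection from faces of $ASM_n$ to elementary flow grids, with inverse $G\mapsto \operatorname{conv}\{A : A \text{ an } n\times n \text{ ASM with } g(A)\subseteq G\}$.
   Context: An alternating sign matrix (ASM) is a square matrix with entries in $\{0,1,-1\}$ such that the entries of each row and each column sum to $1$, and the nonzero entries in each row and each column alternate in sign. $ASM_n$ is the convex hull in $\mathbb{R}^{n^2}$ of the $n\times n$ ASMs; its vertices are the ASMs. The complete flow grid $C_n$ is the directed graph with internal vertices $(i,j)$, $1\le i,j\le n$, and boundary vertices $(i,0),(0,j),(i,n+1),(n+1,j)$, $1\le i,j\le n$, with edge set $\{((i,j),(i,j\pm1)),((i,j),(i\pm1,j)) : 1\le i,j\le n\}$. A simple flow grid of order $n$ is a subgraph of $C_n$ containing all vertices of $C_n$ in which each internal vertex has exactly four incident edges, either all directed inward, all directed outward, or with the two horizontal edges pointing in the same direction and the two vertical edges pointing in the same direction. For an ASM $A=(a_{ij})$, $g(A)$ is the simple flow grid containing an edge $(v,w)$ of $C_n$, $v=(i,j)$, iff the partial sum of the row (for horizontal $(v,w)$) or column (for vertical $(v,w)$) of $A$ from the border on the side opposite $w$ up to and including $a_{ij}$ equals $1$; $A\mapsto g(A)$ is a bijection between ASMs and simple flow grids. An elementary flow grid is a subgraph of $C_n$ whose edge set is a union of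 edge sets of simple flow grids. *)

(* Defs.v *)
From mathcomp Require Import all_boot all_order all_algebra.
From mathcomp Require Import boolp classical_sets functions reals.

Set Implicit Arguments.
Unset Strict Implicit.
Unset Printing Implicit Defensive.

Import GRing.Theory Num.Theory.
Local Open Scope classical_set_scope.
Local Open Scope ring_scope.

(** Convex hulls and faces in the space ['M[R]_n] of real [n x n] matrices. *)

Definition conv (R : realType) (n : nat) (S : set 'M[R]_n) : set 'M[R]_n :=
  [set x | exists (m : nat) (v : 'I_m -> 'M[R]_n) (a : 'I_m -> R),
    [/\ forall k, S (v k),
        forall k, 0 <= a k,
        \sum_(k < m) a k = 1
      & x = \sum_(k < m) a k *: v k]].

Definition dotmx (R : realType) (n : nat) (c x : 'M[R]_n) : R :=
  \sum_(i < n) \sum_(j < n) c i j * x i j.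

(* The functional [c] may be zero, so [P] itself ([c = 0], [b = 0]) and the
   empty set ([c = 0], [b = 1]) are faces of [P]. *)
Definition faces (R : realType) (n : nat) (P : set 'M[R]_n) :
    set (set 'M[R]_n) :=
  [set F | exists (c : 'M[R]_n) (b : R),
    (forall x, P x -> dotmx c x <= b) /\
    F = P `&` [set x | dotmx c x = b]].

Definition vertices (R : realType) (n : nat) (P : set 'M[R]_n) :
    set 'M[R]_n :=
  [set v | faces P [set v]].

Definition is_ASM (R : realType) (n : nat) (A : 'M[R]_n) : Prop :=
  [/\ forall i j, [\/ A i j = 0, A i j = 1 | A i j = -1],
      forall i, \sum_(j < n) A i j = 1,
      forall j, \sum_(i < n) A i j = 1,
      forall i (j k : 'I_n), (j < k)%N -> A i j != 0 -> A i k != 0 ->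
        (forall l : 'I_n, (j < l < k)%N -> A i l = 0) -> A i k = - A i j
    & forall j (i k : 'I_n), (i < k)%N -> A i j != 0 -> A k j != 0 ->
        (forall l : 'I_n, (i < l < k)%N -> A l j = 0) -> A k j = - A i j].

Definition ASM_polytope (R : realType) (n : nat) : set 'M[R]_n :=
  conv (@is_ASM R n).
Arguments ASM_polytope : clear implicits.

(** Flow grids.  A vertex [(i, j)] is in row [i] (numbered downwards) and
    column [j].  All the subgraphs of the complete flow grid considered here
    contain all of its vertices, so a grid is identified with its edge set;
    an edge [(v, w)] is directed from [v] to [w]. *)

Definition vertex : Type := (nat * nat)%type.
Definition edge : Type := (vertex * vertex)%type.
Definition grid : Type := set edge.

Definition internal (n : nat) : set vertex :=
  [set v | (1 <= v.1 <= n)%N && (1 <= v.2 <= n)%N].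

Definition lft (v : vertex) : vertex := (v.1, v.2.-1).
Definition rgt (v : vertex) : vertex := (v.1, v.2.+1).
Definition abv (v : vertex) : vertex := (v.1.-1, v.2).
Definition blw (v : vertex) : vertex := (v.1.+1, v.2).

Definition complete_flow_grid (n : nat) : grid :=
  [set e | internal n e.1 /\
    [\/ e.2 = lft e.1, e.2 = rgt e.1, e.2 = abv e.1 | e.2 = blw e.1]].

Definition incident (G : grid) (v : vertex) : set edge :=
  [set e | G e /\ (e.1 = v \/ e.2 = v)].

Definition all_in (v : vertex) : set edge :=
  [set (lft v, v); (rgt v, v); (abv v, v); (blw v, v)].
Definition all_out (v : vertex) : set edge :=
  [set (v, lft v); (v, rgt v); (v, abv v); (v, blw v)].

Definition rightward (v : vertex) : set edge := [set (lft v, v); (v, rgt v)].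
Definition leftward (v : vertex) : set edge := [set (rgt v, v); (v, lft v)].
Definition downward (v : vertex) : set edge := [set (abv v, v); (v, blw v)].
Definition upward (v : vertex) : set edge := [set (blw v, v); (v, abv v)].

Definition simple_flow_grid (n : nat) : set grid :=
  [set G | G `<=` complete_flow_grid n /\
    forall v, internal n v ->
      [\/ incident G v = all_in v,
          incident G v = all_out v
        | exists H V : set edge,
            [/\ H = rightward v \/ H = leftward v,
                V = downward v \/ V = upward v
              & incident G v = H `|` V]]].

Definition elementary_flow_grid (n : nat) : set grid :=
  [set G | exists S : set grid,
    S `<=` simple_flow_grid n /\ G = \bigcup_(H in S) H].

(* The matrix entry with 0-based indices [i, j : 'I_n] sits at the internal
   vertex [(i.+1, j.+1)].  The four cases are the edges to the right, to the
   left, downwards and upwards; the partial sums run from the left, right, top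
   and bottom border respectively. *)
Definition gmx (R : realType) (n : nat) (A : 'M[R]_n) : grid :=
  [set e | exists i j : 'I_n, e.1 = (i.+1, j.+1) /\
    [\/ e.2 = rgt e.1 /\ \sum_(k < n | (k <= j)%N) A i k = 1,
        e.2 = lft e.1 /\ \sum_(k < n | (j <= k)%N) A i k = 1,
        e.2 = blw e.1 /\ \sum_(k < n | (k <= i)%N) A k j = 1
      | e.2 = abv e.1 /\ \sum_(k < n | (i <= k)%N) A k j = 1]].

Definition gface (R : realType) (n : nat) (F : set 'M[R]_n) : grid :=
  \bigcup_(A in vertices F) gmx A.

Definition face_of_grid (R : realType) (n : nat) (G : grid) : set 'M[R]_n :=
  conv [set A : 'M[R]_n | is_ASM A /\ gmx A `<=` G].
Arguments face_of_grid : clear implicits.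

Definition is_inclusion_lattice (T : Type) (X : set (set T)) : Prop :=
  forall A B, X A -> X B ->
    (exists M, [/\ X M, M `<=` A, M `<=` B
      & forall C, X C -> C `<=` A -> C `<=` B -> C `<=` M]) /\
    (exists J, [/\ X J, A `<=` J, B `<=` J
      & forall C, X C -> A `<=` C -> B `<=` C -> J `<=` C]).

(* Main.v *)
(** A row of an alternating sign matrix is encoded by its partial sums, which
    all lie in [{0, 1}] and give the orientations of the horizontal edges of
    the flow grid; similarly for columns.  The linear form summing the partial
    sums attached to the edges outside a grid [G] is nonnegative on ASMs and
    vanishes exactly when [gmx A `<=` G], so [face_of_grid G] is a face.

    Conversely, let [F] be a face cut out by [c x = b], and [B] an ASM whose
    edges are all covered by ASMs [A_1, ..., A_N] of [F].  The corner sums of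
    [\sum_k A_k - B] form an integer matrix [H] whose horizontal and vertical
    increments lie in [[0, N - 1]].  By Hermite's identity [H] is the sum of
    the [N - 1] matrices [(H + m) %/ (N - 1)], each of which is the corner sum
    matrix of an ASM [C_m].  Evaluating [c] on [\sum_k A_k = B + \sum_m C_m]
    gives [N b <= c B + (N - 1) b], hence [B] lies in [F]. *)

From mathcomp Require Import all_boot all_order all_algebra.
From mathcomp Require Import boolp classical_sets functions reals.
From mathcomp Require Import zify lra.
Require Import Defs.

Set Implicit Arguments.
Unset Strict Implicit.
Unset Printing Implicit Defensive.

Import Order.TTheory GRing.Theory Num.Theory.

Local Open Scope classical_set_scope.
Local Open Scope ring_scope.

(** * The pairing [dotmx] as a bilinear form on matrices *)

Section LinearForms.
Variables (R : realType) (n : nat).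
Implicit Types (c x y : 'M[R]_n).

Lemma dotmxC c x : dotmx c x = dotmx x c.
Proof. by apply: eq_bigr => i _; apply: eq_bigr => j _; rewrite mulrC. Qed.

Lemma dotmx0r c : dotmx c 0 = 0.
Proof. by apply: big1 => i _; apply: big1 => j _; rewrite mxE mulr0. Qed.

Lemma dotmx0l x : dotmx 0 x = 0.
Proof. by rewrite dotmxC dotmx0r. Qed.

Lemma dotmxDr c x y : dotmx c (x + y) = dotmx c x + dotmx c y.
Proof.
rewrite /dotmx -big_split; apply: eq_bigr => i _; rewrite -big_split.
by apply: eq_bigr => j _; rewrite mxE mulrDr.
Qed.

Lemma dotmxZr a c x : dotmx c (a *: x) = a * dotmx c x.
Proof.
rewrite /dotmx big_distrr; apply: eq_bigr => i _; rewrite big_distrr.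
by apply: eq_bigr => j _; rewrite mxE mulrCA.
Qed.

Lemma dotmx_sumr (I : Type) (r : seq I) (P : pred I) c (F : I -> 'M[R]_n) :
  dotmx c (\sum_(k <- r | P k) F k) = \sum_(k <- r | P k) dotmx c (F k).
Proof. by apply: big_morph; [exact: dotmxDr | exact: dotmx0r]. Qed.

Lemma dotmx_suml (I : Type) (r : seq I) (P : pred I) (F : I -> 'M[R]_n) x :
  dotmx (\sum_(k <- r | P k) F k) x = \sum_(k <- r | P k) dotmx (F k) x.
Proof. by rewrite dotmxC dotmx_sumr; apply: eq_bigr => k _; rewrite dotmxC. Qed.

Lemma dotmxNl c x : dotmx (- c) x = - dotmx c x.
Proof. by rewrite dotmxC -scaleN1r dotmxZr mulN1r dotmxC. Qed.

Lemma dotmx_delta i j x : dotmx (delta_mx i j) x = x i j.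
Proof.
rewrite /dotmx (bigD1 i) //= (bigD1 j) //= mxE !eqxx mul1r.
rewrite !big1 ?addr0 // => [k ki|k kj].
  by apply: big1 => l _; rewrite mxE (negbTE ki) mul0r.
by rewrite mxE (negbTE kj) andbF mul0r.
Qed.

End LinearForms.

(** * Convex hulls, their faces and their vertices *)

Section ConvexHulls.
Variables (R : realType) (n : nat).
Implicit Types (S : set 'M[R]_n) (c x : 'M[R]_n).

Lemma subset_conv S : S `<=` conv S.
Proof.
move=> x Sx; exists 1%N, (fun=> x), (fun=> 1); split=> //.
  by rewrite big_ord1.
by rewrite big_ord1 scale1r.
Qed.

Lemma conv_mono S S' : S `<=` S' -> conv S `<=` conv S'.
Proof. by move=> SS' x [m [v [a [Sv a0 a1 ->]]]]; exists m, v, a; split=> // k; apply: SS'. Qed.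

Lemma conv_le S c b x :
  (forall y, S y -> dotmx c y <= b) -> conv S x -> dotmx c x <= b.
Proof.
move=> cb [m [v [a [Sv a0 a1 ->]]]]; rewrite dotmx_sumr -[b]mul1r -a1 mulr_suml.
by apply: ler_sum => k _; rewrite dotmxZr ler_wpM2l // cb.
Qed.

Lemma conv_set1 x : conv [set x] = [set x].
Proof.
apply/seteqP; split; last exact: subset_conv.
move=> y [m [v [a [Sv _ a1 ->]]]] /=.
by rewrite (eq_bigr (fun k => a k *: x)) -?scaler_suml ?a1 ?scale1r // => k _; rewrite Sv.
Qed.

Lemma conv0 : conv (set0 : set 'M[R]_n) = set0.
Proof.
rewrite -subset0 => x [[|m] [v [a [Sv _ a1 _]]]]; last by case: (Sv ord0).
by move: a1; rewrite big_ord0 => /eqP; rewrite eq_sym oner_eq0.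
Qed.

(** A convex combination reaches the bound [b] only if every point of nonzero weight does. *)
Lemma conv_face S c b : (forall x, S x -> dotmx c x <= b) ->
  conv S `&` [set x | dotmx c x = b] = conv (S `&` [set x | dotmx c x = b]).
Proof.
move=> cb; apply/seteqP; split=> [x [[m [v [a [Sv a0 a1 ->]]]] /= xb]|x cx]; last first.
  split; first by apply: conv_mono cx => y [].
  apply/eqP; rewrite eq_le (conv_le _ cx) => [/=|y [_ /= ->] //].
  rewrite -lerN2 -dotmxNl; apply: conv_le cx => y [_ /= yb].
  by rewrite dotmxNl yb.
have vb k : a k != 0 -> dotmx c (v k) = b.
  move=> ak; have ge0 l : true -> 0 <= a l * (b - dotmx c (v l)).
    by move=> _; rewrite mulr_ge0 // subr_ge0 cb.
  have /psumr_eq0P /(_ k isT)/eqP : \sum_l a l * (b - dotmx c (v l)) = 0.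
    under eq_bigr do rewrite mulrBr.
    rewrite sumrB -mulr_suml a1 mul1r -{1}xb dotmx_sumr.
    by under eq_bigr do rewrite dotmxZr; rewrite subrr.
  by move=> /(_ ge0); rewrite mulf_eq0 (negbTE ak) /= subr_eq0 => /eqP.
have [k0 ak0] : exists k0, a k0 != 0.
  apply: contrapT => /forallNP an0; move: a1; rewrite big1 => [/eqP|k _].
    by rewrite eq_sym oner_eq0.
  by have /negP := an0 k; rewrite negbK => /eqP.
(* Points of weight zero may lie off the hyperplane, so they are replaced by [v k0]; the combination
   is unchanged. *)
exists m, (fun k => if a k == 0 then v k0 else v k), a; split=> //.
  by move=> k; case: ifPn => ak; split=> //=; apply: vb.
by apply: eq_bigr => k _; case: ifPn => // /eqP ->; rewrite !scale0r.
Qed.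

Lemma face_convE S F : faces (conv S) F ->
  exists c b, [/\ forall x, S x -> dotmx c x <= b
    & F = conv (S `&` [set x | dotmx c x = b])].
Proof.
move=> [c [b [cb ->]]]; have cbS x : S x -> dotmx c x <= b.
  by move=> /subset_conv; apply: cb.
by exists c, b; split; rewrite ?conv_face.
Qed.

Lemma faces_conv S c b : (forall x, S x -> dotmx c x <= b) ->
  faces (conv S) (conv (S `&` [set x | dotmx c x = b])).
Proof.
by move=> cb; exists c, b; split=> [x|]; [exact: (conv_le cb) | rewrite conv_face].
Qed.

(** The face [{v}] is spanned by the points of [S] on a supporting hyperplane; there is at least one
    such point, and it must be [v]. *)
Lemma vertices_conv_sub S : vertices (conv S) `<=` S.
Proof.
move=> v /face_convE[c [b [_ vE]]].
have [m [w [a [Sw a0 a1 _]]]] : conv (S `&` [set x | dotmx c x = b]) v by rewrite -vE.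
case: m w a Sw a0 a1 => [w a _ _|m w a Sw _ _].
  by rewrite big_ord0 => /eqP; rewrite eq_sym oner_eq0.
by have /subset_conv := Sw ord0; rewrite -vE /= => <-; have [] := Sw ord0.
Qed.

Lemma vertices_set0 : vertices (set0 : set 'M[R]_n) = set0.
Proof.
by rewrite -subset0 -{1}conv0; exact: vertices_conv_sub.
Qed.

End ConvexHulls.

(** * Partial sums of alternating sequences *)

Section PartialSums.

Lemma big_ord_ltnS (T : Type) (idx : T) (op : Monoid.com_law idx) (n : nat)
    (F : 'I_n -> T) (j : 'I_n) :
  \big[op/idx]_(l < n | (l < j.+1)%N) F l =
  op (\big[op/idx]_(l < n | (l < j)%N) F l) (F j).
Proof.
rewrite (bigD1 j) //= Monoid.mulmC; congr (op _ _); apply: eq_bigl => l.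
by rewrite ltnS andbC -val_eqE /= -ltn_neqAle.
Qed.

Lemma big_ord_ltn0 (T : Type) (idx : T) (op : T -> T -> T) (n : nat)
    (F : 'I_n -> T) : \big[op/idx]_(l < n | (l < 0)%N) F l = idx.
Proof. by rewrite big_pred0. Qed.

Lemma big_ord_ltnn (T : Type) (idx : T) (op : T -> T -> T) (n : nat)
    (F : 'I_n -> T) : \big[op/idx]_(l < n | (l < n)%N) F l = \big[op/idx]_(l < n) F l.
Proof. by apply: eq_bigl => l; rewrite ltn_ord. Qed.

Variables (R : realType) (n : nat).
Implicit Types (f : 'I_n -> R) (A : 'M[R]_n).

Definition psum f (k : nat) : R := \sum_(l < n | (l < k)%N) f l.

Definition bsum f (k : nat) : bool := psum f k == 1.

Definition alternating f : Prop :=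
  [/\ forall l, [\/ f l = 0, f l = 1 | f l = -1],
      \sum_l f l = 1
    & forall j k : 'I_n, (j < k)%N -> f j != 0 -> f k != 0 ->
        (forall l : 'I_n, (j < l < k)%N -> f l = 0) -> f k = - f j].

Lemma psumS f (j : 'I_n) : psum f j.+1 = psum f j + f j.
Proof. exact: big_ord_ltnS. Qed.

Lemma psum0 f : psum f 0 = 0.
Proof. exact: big_ord_ltn0. Qed.

Lemma psumn f : psum f n = \sum_l f l.
Proof. exact: big_ord_ltnn. Qed.

Lemma psum_geq f (j : 'I_n) :
  \sum_(l < n | (j <= l)%N) f l = \sum_l f l - psum f j.
Proof.
rewrite [X in _ = X - _](bigID (fun l : 'I_n => (l < j)%N)) /= -/(psum f j) addrAC subrr add0r.
by apply: eq_bigl => l; rewrite -leqNgt.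
Qed.

Lemma is_ASM_alternating A :
  is_ASM A <-> (forall i, alternating (A i)) /\ (forall j, alternating (A^~ j)).
Proof.
split=> [[e r c ar ac]|[r c]]; first by split=> i; split=> // *; [exact: ar | exact: ac].
by split=> [i|i|j|i|j]; [case: (r i)|case: (r i)|case: (c j)|case: (r i)|case: (c j)].
Qed.

(* [d] is the sign of the first nonzero entry met, [p] the position of the
   last one: the partial sum is then [(f p + d) / 2]. *)
Lemma alternating_psum f k : alternating f -> (k <= n)%N ->
  psum f k = 0 \/ psum f k = 1.
Proof.
move=> [f01 f1 falt].
pose inv k := (forall l : 'I_n, (l < k)%N -> f l = 0) /\
    (forall q, (q <= k)%N -> psum f q = 0) \/
  exists (p : 'I_n) (d : R), [/\ (p < k)%N, f p != 0,
    forall l : 'I_n, (p < l < k)%N -> f l = 0,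
    2 * psum f k = f p + d &
    (d = 1 \/ d = -1) /\ forall q, (q <= k)%N -> psum f q = 0 \/ psum f q = d].
have invP q : (q <= n)%N -> inv q.
  elim: q => [_|q IHq ltqn]; first by left; split=> // q; rewrite leqn0 => /eqP ->; exact: psum0.
  pose o := Ordinal ltqn.
  have lt_case (l : 'I_n) : (l < q.+1)%N -> l = o \/ (l < q)%N.
    by rewrite ltnS leq_eqVlt => /orP[/eqP lq|]; [left; apply: val_inj | right].
  have le_case m : (m <= q.+1)%N -> m = q.+1 \/ (m <= q)%N.
    by rewrite leq_eqVlt => /orP[/eqP|]; [left | right].
  have So : psum f q.+1 = psum f q + f o by exact: (psumS f o).
  have [fo|fo] := eqVneq (f o) 0.
    have {}So : psum f q.+1 = psum f q by rewrite So fo addr0.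
    case: (IHq (ltnW ltqn)) => [[z s]|[p [d [pq fp z s [d1 sd]]]]]; [left|right].
      split=> [l /lt_case[->|/z] //|m /le_case[->|/s] //].
      by rewrite So s.
    exists p, d; split=> //; first exact: ltnW.
    - by move=> l /andP[pl /lt_case[->|lq]] //; apply: z; rewrite pl.
    - by rewrite So.
    by split=> // m /le_case[->|/sd//]; rewrite So; apply: sd.
  have fo1 : f o = 1 \/ f o = -1.
    by case: (f01 o) => [/eqP|->|->]; [rewrite (negbTE fo) | left | right].
  right; case: (IHq (ltnW ltqn)) => [[z s]|[p [d [pq fp z s [d1 sd]]]]].
    exists o, (f o); split=> //.
    - by move=> l /= /andP[h1 h2]; lia.
    - by rewrite So s //; lra.
    split=> // m /le_case[->|/s ->]; last by left.
    by right; rewrite So s // add0r.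
  have fE : f o = - f p by apply: falt.
  exists o, d; split=> //.
  - by move=> l /= /andP[h1 h2]; lia.
  - by rewrite So; lra.
  split=> // m /le_case[->|/sd //].
  have : 2 * psum f q.+1 = f o + d by rewrite So; lra.
  by case: d1 => -> ; case: fo1 => -> h; [right|left|left|right]; lra.
move=> kn; case: (invP n (leqnn n)) => [[_ /(_ n (leqnn n))]|].
  by rewrite psumn f1 => /eqP; rewrite oner_eq0.
move=> [p [d [_ _ _ _ [d1 sd]]]].
(* The total 1 must be 0 or [d], which excludes [d = -1]. *)
have := sd n (leqnn n); rewrite psumn f1; case: d1 => dE; move: sd; rewrite dE.
  by move=> sd _; apply: sd.
by move=> _ [] /eqP; [rewrite oner_eq0 | move=> /eqP h; exfalso; lra].
Qed.

Lemma psumE f k : alternating f -> (k <= n)%N -> psum f k = (bsum f k)%:R.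
Proof.
move=> fa kn; rewrite /bsum; have [->|->] := alternating_psum fa kn.
  by rewrite eq_sym oner_eq0.
by rewrite eqxx.
Qed.

Lemma alternating_diff f (j : 'I_n) : alternating f ->
  f j = (bsum f j.+1)%:R - (bsum f j)%:R.
Proof.
by move=> fa; rewrite -!psumE // 1?ltnW // psumS addrC addKr.
Qed.

Lemma bsum0 f : bsum f 0 = false.
Proof. by rewrite /bsum psum0 eq_sym oner_eq0. Qed.

Lemma bsumn f : alternating f -> bsum f n.
Proof. by case=> _ f1 _; rewrite /bsum psumn f1 eqxx. Qed.

Lemma bsum_of_diff f (b : nat -> bool) k :
  (forall j : 'I_n, f j = (b j.+1)%:R - (b j)%:R) -> b 0 = false ->
  (k <= n)%N -> bsum f k = b k.
Proof.
move=> fb b0 kn; rewrite /bsum.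
suff -> : psum f k = (b k)%:R by case: (b k); rewrite ?eqxx // eq_sym oner_eq0.
elim: k kn => [|k IHk] kn; first by rewrite psum0 b0.
by rewrite (psumS f (Ordinal kn)) fb IHk 1?ltnW //= addrC subrK.
Qed.

(** [b] is constant between two consecutive nonzero entries, so the second one has to undo the jump
    made by the first. *)
Lemma alternating_of_diff f (b : nat -> bool) :
  (forall j : 'I_n, f j = (b j.+1)%:R - (b j)%:R) -> b 0 = false -> b n ->
  alternating f.
Proof.
move=> fb b0 bn; split.
- by move=> l; rewrite fb; case: (b l.+1); case: (b l); rewrite ?subrr ?subr0 ?sub0r;
     [constructor 1|constructor 2|constructor 3|constructor 1].
- by rewrite -psumn; apply/eqP; have := bsum_of_diff fb b0 (leqnn n); rewrite bn.
move=> j k jk fj fk z.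
have bE m : (j < m <= k)%N -> b m = b j.+1.
  elim: m => [//|m IHm] /andP[jm mk].
  move: jm; rewrite ltnS leq_eqVlt => /orP[/eqP -> //|jm].
  rewrite -IHm ?jm 1?ltnW //.
  have mn : (m < n)%N by exact: ltn_trans mk (ltn_ord k).
  have := z (Ordinal mn); rewrite /= jm mk fb /= => /(_ isT) /eqP.
  by rewrite subr_eq0 eqr_nat; case: (b _); case: (b _).
move: fj fk; rewrite !fb (bE k) ?jk ?leqnn //.
by case: (b k.+1); case: (b j.+1); case: (b j); rewrite ?subrr ?eqxx // ?subr0 ?sub0r ?opprK.
Qed.

End PartialSums.

(** * The exchange identity, obtained by rounding corner sums *)

Section Exchange.

(** Hermite's identity, by induction on [x]: raising [x] by one trades the term [x %/ M] for
    [(x + M) %/ M], which is larger by one. *)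
Lemma sum_divn_shift (M x : nat) : (0 < M)%N -> (\sum_(m < M) (x + m) %/ M = x)%N.
Proof.
case: M => // M _; elim: x => [|x IHx].
  by apply: big1 => m _; rewrite add0n divn_small.
pose g m := ((x + m) %/ M.+1)%N.
rewrite (eq_bigr (fun m : 'I_M.+1 => g m.+1)) => [|m _]; last by rewrite addSnnS.
rewrite -[in RHS]IHx big_ord_recr big_ord_recl /= -/(g 0%N) -addSn addnC.
by congr addn; rewrite /g divnDr ?dvdnn // divnn addn0 addn1.
Qed.

Lemma leq_divD (M x d : nat) : (0 < M)%N -> (d <= M)%N ->
  (x %/ M <= (x + d) %/ M <= (x %/ M).+1)%N.
Proof.
move=> M0 dM; rewrite leq_div2r ?leq_addr //=.
have -> : ((x %/ M).+1 = (x + M) %/ M)%N by rewrite divnDr // divnn M0 addn1.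
by rewrite leq_div2r // leq_add2l.
Qed.

Variables (R : realType) (n : nat).
Implicit Types (A B : 'M[R]_n).

(** Both sides are the sum of the entries in the top left [p] by [q] corner. *)
Lemma corner_sum A p q : is_ASM A -> (p <= n)%N -> (q <= n)%N ->
  (\sum_(i < n | (i < p)%N) bsum (A i) q =
   \sum_(j < n | (j < q)%N) bsum (A^~ j) p)%N.
Proof.
move=> /is_ASM_alternating[ar ac] pn qn; apply/eqP; rewrite -(eqr_nat R) !natr_sum.
under eq_bigr do rewrite -psumE //.
by under [X in _ == X]eq_bigr do rewrite -psumE //; rewrite exchange_big.
Qed.

Lemma asm_of_diff A (r u : nat -> nat -> bool) :
  (forall i j : 'I_n, A i j = (r i j.+1)%:R - (r i j)%:R) ->
  (forall i j : 'I_n, A i j = (u i.+1 j)%:R - (u i j)%:R) ->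
  (forall i : 'I_n, ~~ r i 0 && r i n) -> (forall j : 'I_n, ~~ u 0 j && u n j) ->
  is_ASM A.
Proof.
move=> Ar Au r01 u01; apply/is_ASM_alternating; split=> i.
  have /andP[/negbTE r0 r1] := r01 i.
  exact: (@alternating_of_diff _ _ _ (r i)).
have /andP[/negbTE u0 u1] := u01 i.
by apply: (@alternating_of_diff _ _ _ (u^~ i)) => // j; exact: Au.
Qed.

Section Slices.
Variables (M : nat) (H : nat -> nat -> nat).
Hypothesis M0 : (0 < M)%N.
Hypothesis H0q : forall q, (q <= n)%N -> H 0 q = 0%N.
Hypothesis Hp0 : forall p, (p <= n)%N -> H p 0 = 0%N.
Hypothesis HSp : forall p q, (p < n)%N -> (q <= n)%N ->
  exists2 d, (d <= M)%N & H p.+1 q = (H p q + d)%N.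
Hypothesis HSq : forall p q, (p <= n)%N -> (q < n)%N ->
  exists2 d, (d <= M)%N & H p q.+1 = (H p q + d)%N.
Hypothesis Hpn : forall p, (p < n)%N -> H p.+1 n = (H p n + M)%N.
Hypothesis Hnq : forall q, (q < n)%N -> H n q.+1 = (H n q + M)%N.

Let f m p q := ((H p q + m) %/ M)%N.

(** A matrix is the mixed second difference of its corner sums; here these are the rounded values
    [(H + m) %/ M]. *)
Definition slice (m : nat) : 'M[R]_n :=
  \matrix_(i, j) ((f m i.+1 j.+1)%:R - (f m i j.+1)%:R
                  - ((f m i.+1 j)%:R - (f m i j)%:R)).

Let fdiff m p q p' q' d : (d <= M)%N -> H p' q' = (H p q + d)%N ->
  (f m p' q' != f m p q)%:R = (f m p' q')%:R - (f m p q)%:R :> R.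
Proof.
move=> dM Hd; have := leq_divD (H p q + m) M0 dM.
rewrite addnAC -Hd -/(f m p q) -/(f m p' q') => /andP[le1 le2].
case: eqP => [->|/eqP ne]; first by rewrite subrr.
have -> : f m p' q' = (f m p q).+1 by apply/eqP; rewrite eqn_leq le2 ltn_neqAle eq_sym ne.
by rewrite -natr1 addrC addKr.
Qed.

(** An increment of [H] of at most [M] changes the quotient by 0 or 1, which makes the partial sums
    boolean. They start at 0 because [H] vanishes on the top and left borders, and end at 1 because
    [H] grows by exactly [M] at each step along the bottom and right borders. *)
Lemma slice_ASM m : (m < M)%N -> is_ASM (slice m).
Proof.
move=> mM.
have fp (i j : nat) : (i < n)%N -> (j <= n)%N ->
    (f m i.+1 j != f m i j)%:R = (f m i.+1 j)%:R - (f m i j)%:R :> R.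
  by move=> ltin lejn; have [d dM] := HSp ltin lejn; exact: fdiff.
have fq (i j : nat) : (i <= n)%N -> (j < n)%N ->
    (f m i j.+1 != f m i j)%:R = (f m i j.+1)%:R - (f m i j)%:R :> R.
  by move=> lein ltjn; have [d dM] := HSq lein ltjn; exact: fdiff.
have f_neq p q p' q' : H p' q' = (H p q + M)%N -> f m p' q' != f m p q.
  by move=> HM; rewrite /f HM addnAC divnDr ?dvdnn // divnn M0 addn1 neq_ltn ltnSn orbT.
have f0 p q p' q' : H p q = 0%N -> H p' q' = 0%N -> f m p' q' = f m p q.
  by rewrite /f => -> ->.
apply: (@asm_of_diff _ (fun i q => f m i.+1 q != f m i q)
                       (fun p j => f m p j.+1 != f m p j)).
- by move=> i j; rewrite mxE !fp // ltnW.
- by move=> i j; rewrite mxE !fq //; [lra | exact: ltnW].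
- by move=> i; rewrite negbK (f0 i 0%N i.+1 0%N) ?Hp0 ?eqxx //= ?f_neq ?Hpn // ltnW.
by move=> j; rewrite negbK (f0 0%N j 0%N j.+1) ?H0q ?eqxx //= ?f_neq ?Hnq // ltnW.
Qed.

Lemma sum_slice (i j : 'I_n) : (\sum_(m < M) slice m) i j =
  (H i.+1 j.+1)%:R - (H i j.+1)%:R - ((H i.+1 j)%:R - (H i j)%:R).
Proof.
rewrite summxE; under eq_bigr do rewrite mxE.
by rewrite !sumrB -!natr_sum !sum_divn_shift.
Qed.

End Slices.

Variables (K : finType) (A : K -> 'M[R]_n) (B : 'M[R]_n).
Hypotheses (K1 : (1 < #|K|)%N) (asmA : forall k, is_ASM (A k)) (asmB : is_ASM B).
Hypothesis rowB : forall (i : 'I_n) q, (q <= n)%N ->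
  exists k, bsum (A k i) q = bsum (B i) q.
Hypothesis colB : forall (j : 'I_n) p, (p <= n)%N ->
  exists k, bsum ((A k)^~ j) p = bsum (B^~ j) p.

(** Removing one term equal to [b] leaves a sum of [#|K|.-1] booleans. *)
Lemma sum_bool_between (a : K -> bool) (b : bool) : (exists k, a k = b) ->
  (b <= \sum_k a k)%N /\ (\sum_k a k - b <= #|K|.-1)%N.
Proof.
move=> [k ak]; rewrite (bigD1 k) //= ak leq_addr addKn; split=> //.
apply: (@leq_trans (\sum_(l | l != k) 1)%N); first by apply: leq_sum => l _; case: (a l).
by rewrite sum1_card cardC1.
Qed.

(** By [sum_bool_between] the truncated subtractions in [Drow] and [Dcol] are exact for indices up
    to [n], so [H] consists of the corner sums of [\sum_k A k - B]. *)
Let Drow (i : 'I_n) q := (\sum_k bsum (A k i) q - bsum (B i) q)%N.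
Let Dcol (j : 'I_n) p := (\sum_k bsum ((A k)^~ j) p - bsum (B^~ j) p)%N.
Let H p q := (\sum_(i < n | (i < p)%N) Drow i q)%N.

Let HB p q : (q <= n)%N -> (H p q + \sum_(i < n | (i < p)%N) bsum (B i) q =
  \sum_k \sum_(i < n | (i < p)%N) bsum (A k i) q)%N.
Proof.
move=> qn; rewrite exchange_big -big_split; apply: eq_bigr => i _ /=.
by rewrite subnK //; case: (sum_bool_between (rowB i qn)).
Qed.

(** By [corner_sum], adding up by rows or by columns gives the same [H]; the column form exhibits
    its horizontal increments. *)
Let HE p q : (p <= n)%N -> (q <= n)%N -> H p q = (\sum_(j < n | (j < q)%N) Dcol j p)%N.
Proof.
move=> pn qn; apply/eqP; rewrite -(eqn_add2r (\sum_(i < n | (i < p)%N) bsum (B i) q)); apply/eqP.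
rewrite HB // (eq_bigr _ (fun k _ => corner_sum (asmA k) pn qn)) corner_sum //.
rewrite exchange_big -big_split; apply: eq_bigr => i _ /=.
by rewrite subnK //; case: (sum_bool_between (colB i pn)).
Qed.

Lemma exchange : exists C : 'I_#|K|.-1 -> 'M[R]_n,
  (forall m, is_ASM (C m)) /\ \sum_k A k = B + \sum_m C m.
Proof.
have M0 : (0 < #|K|.-1)%N by rewrite -ltnS prednK // ltnW.
have Hp (i : 'I_n) q : H i.+1 q = (H i q + Drow i q)%N by exact: big_ord_ltnS.
have Hq p (j : 'I_n) : (p <= n)%N -> H p j.+1 = (H p j + Dcol j p)%N.
  by move=> pn; rewrite !HE // 1?ltnW //; exact: big_ord_ltnS.
have [arA acA] : (forall k i, alternating (A k i)) /\ (forall k j, alternating ((A k)^~ j)).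
  by split=> k i; have /is_ASM_alternating[] := asmA k.
have /is_ASM_alternating[arB acB] := asmB.
exists (fun m => slice #|K|.-1 H m); split.
  move=> m; apply: slice_ASM => //.
  - by move=> q _; exact: big_ord_ltn0.
  - by move=> p pn; rewrite HE //; exact: big_ord_ltn0.
  - move=> p q pn qn; exists (Drow (Ordinal pn) q); last exact: (Hp (Ordinal pn)).
    by case: (sum_bool_between (rowB (Ordinal pn) qn)).
  - move=> p q pn qn; exists (Dcol (Ordinal qn) p); last exact: (Hq p (Ordinal qn)).
    by case: (sum_bool_between (colB (Ordinal qn) pn)).
  (* At the last column every row sum is 1, so the increment is exactly [#|K| - 1]; the last row is
     treated likewise. *)
  - move=> p pn; rewrite (Hp (Ordinal pn)) /Drow bsumn //=.
    by under eq_bigr do rewrite bsumn //; rewrite sum1_card subn1.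
  move=> q qn; rewrite (Hq n (Ordinal qn)) // /Dcol bsumn //=.
  by under eq_bigr do rewrite bsumn //; rewrite sum1_card subn1.
apply/matrixP => i j; rewrite mxE sum_slice //.
rewrite !Hp !natrD !(addrC (H i _)%:R) !addrK /Drow.
rewrite !natrB; last 2 first.
- by case: (sum_bool_between (rowB i (ltnW (ltn_ord j)))).
- by case: (sum_bool_between (rowB i (ltn_ord j))).
rewrite !natr_sum summxE (alternating_diff j (arB i)).
rewrite [X in X = _](eq_bigr _ (fun k _ => alternating_diff j (arA k i))).
by rewrite sumrB; lra.
Qed.

End Exchange.

(** * Simple flow grids as orientations of the grid lines *)

Section Grids.
Variables (n : nat).

(* [(i, j, (h, f))] is the edge of the complete flow grid leaving the vertex of
   the entry [(i, j)]: horizontal iff [h], rightwards or downwards iff [f]. *)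
Definition arrow : Type := ('I_n * 'I_n * (bool * bool))%type.

Definition edge_of (e : arrow) : edge :=
  let: (i, j, (h, f)) := e in
  let v : vertex := (i.+1, j.+1) in
  (v, if h then if f then rgt v else lft v else if f then blw v else abv v).

Lemma edge_of_inj : injective edge_of.
Proof.
move=> [[i j] [h f]] [[i' j'] [h' f']] /=.
case=> /val_inj <- /val_inj <-; rewrite /rgt /lft /blw /abv /=.
by case: h; case: f; case: h'; case: f' => // -[]; lia.
Qed.

Definition grid_of (F : arrow -> bool) : grid := [set edge_of e | e in F].

Lemma grid_ofE (F : arrow -> bool) e : grid_of F (edge_of e) <-> F e.
Proof. by split=> [[e' Fe' /edge_of_inj <-]|Fe] //; exists e. Qed.

(** The leftward or upward arrow out of an entry reverses the segment just before it, hence the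
    negation and the index without successor. *)
Definition flow (r u : nat -> nat -> bool) (e : arrow) : bool :=
  let: (i, j, (h, f)) := e in
  if h then if f then r i j.+1 else ~~ r i j
  else if f then u i.+1 j else ~~ u i j.

(* [r i k] (resp. [u k j]) says that the [k]-th edge of row [i] (resp. of
   column [j]) points right (resp. down); [k = 0] and [k = n] are the borders. *)
Record orientation (r u : nat -> nat -> bool) : Prop := Orientation {
  or_row : forall i : 'I_n, ~~ r i 0 && r i n;
  or_col : forall j : 'I_n, ~~ u 0 j && u n j;
  or_node : forall i j : 'I_n, (r i j.+1 + u i j = u i.+1 j + r i j)%N }.

Lemma internalP v : internal n v -> exists i j : 'I_n, v = (i.+1, j.+1).
Proof.
case: v => -[|i] [|j]; rewrite /internal /= ?andbF // => /andP[ltin ltjn].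
by exists (Ordinal ltin), (Ordinal ltjn).
Qed.

Lemma internal_ord (i j : 'I_n) : internal n (i.+1, j.+1).
Proof. by rewrite /internal /= !ltn_ord. Qed.

(** An edge entering [v] is in the grid only as an arrow leaving an internal neighbour; at the
    border, where there is none, [or_row] and [or_col] make the edge point outwards. *)
Lemma incident_grid_of r u (i j : 'I_n) : orientation r u ->
  let v : vertex := (i.+1, j.+1) in
  incident (grid_of (flow r u)) v =
    (if r i j.+1 then [set (v, rgt v)] else [set (rgt v, v)]) `|`
    (if r i j then [set (lft v, v)] else [set (v, lft v)]) `|`
    ((if u i.+1 j then [set (v, blw v)] else [set (blw v, v)]) `|`
     (if u i j then [set (abv v, v)] else [set (v, abv v)])).
Proof.
move=> [rb ub _] v; apply/seteqP; split.
  move=> _ [[[[i' j'] [h f]] /= Fe <-] /= [|]].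
    case=> /val_inj ii /val_inj jj; move: Fe; rewrite /v {}ii {}jj.
    case: h; case: f => /=.
    - by move=> ->; left; left.
    - by move=> /negbTE ->; left; right.
    - by move=> ->; right; left.
    - by move=> /negbTE ->; right; right.
  case: h Fe; case: f => /= Fe.
  - rewrite /v /rgt /= => -[/val_inj ii jj]; subst i'; left; right.
    by rewrite -jj Fe.
  - rewrite /v /lft /= => -[/val_inj ii jj]; subst i'; left; left.
    by rewrite -jj (negbTE Fe) /rgt /= jj.
  - rewrite /v /blw /= => -[ii /val_inj jj]; subst j'; right; right.
    by rewrite -ii Fe.
  - rewrite /v /abv /= => -[ii /val_inj jj]; subst j'; right; left.
    by rewrite -ii (negbTE Fe) /blw /= ii.
have inE e : flow r u e -> (edge_of e).1 = v \/ (edge_of e).2 = v ->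
    incident (grid_of (flow r u)) v (edge_of e).
  by move=> Fe ev; split=> //; apply/grid_ofE.
move=> x [[|]|[|]].
- case: ifPn => h /= ->; first by apply: (inE (i, j, (true, true))) => //; left.
  have ltjn : (j.+1 < n)%N.
    rewrite ltn_neqAle ltn_ord andbT; apply: contra h => /eqP ->.
    by have /andP[] := rb i.
  by apply: (inE (i, Ordinal ltjn, (true, false))) => //; right.
- case: ifPn => h /= ->; last by apply: (inE (i, j, (true, false))) => //; left.
  case: j @v h inE => -[|j] ltjn v /= h inE.
    by have /andP[] := rb i; rewrite h.
  by apply: (inE (i, Ordinal (ltnW ltjn), (true, true))) => //; right.
- case: ifPn => h /= ->; first by apply: (inE (i, j, (false, true))) => //; left.
  have ltin : (i.+1 < n)%N.
    rewrite ltn_neqAle ltn_ord andbT; apply: contra h => /eqP ->.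
    by have /andP[] := ub j.
  by apply: (inE (Ordinal ltin, j, (false, false))) => //; right.
- case: ifPn => h /= ->; last by apply: (inE (i, j, (false, false))) => //; left.
  case: i @v h inE => -[|i] ltin v /= h inE.
    by have /andP[] := ub j; rewrite h.
  by apply: (inE (Ordinal (ltnW ltin), j, (false, true))) => //; right.
Qed.

Lemma grid_of_simple r u : orientation r u -> simple_flow_grid n (grid_of (flow r u)).
Proof.
move=> ru; split.
  move=> _ [[[i j] [h f]] _ <-]; split; first exact: internal_ord.
  by case: h; case: f; [constructor 2|constructor 1|constructor 4|constructor 3].
move=> v /internalP[i [j ->]]; rewrite (incident_grid_of i j ru) /=.
have := or_node ru i j; set v' : vertex := (_, _).
have eqs (S T : set edge) : (forall x, S x <-> T x) -> S = T.
  by move=> ST; apply/seteqP; split=> x /ST.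
(* [or_node] leaves six of the sixteen cases, the local configurations of the six-vertex model. *)
case: (r i j.+1); case: (r i j); case: (u i.+1 j); case: (u i j) => // _.
- constructor 3; exists (rightward v'), (downward v'); split; [by left|by left|].
  by apply: eqs => x; rewrite /rightward /downward /=; tauto.
- constructor 3; exists (rightward v'), (upward v'); split; [by left|by right|].
  by apply: eqs => x; rewrite /rightward /upward /=; tauto.
- by constructor 2; apply: eqs => x; rewrite /all_out /=; tauto.
- by constructor 1; apply: eqs => x; rewrite /all_in /=; tauto.
- constructor 3; exists (leftward v'), (downward v'); split; [by right|by left|].
  by apply: eqs => x; rewrite /leftward /downward /=; tauto.
- constructor 3; exists (leftward v'), (upward v'); split; [by right|by right|].
  by apply: eqs => x; rewrite /leftward /upward /=; tauto.
Qed.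

(** A finite check over the admissible kinds of node. It makes the orientation of each segment well
    defined and yields [or_node]. *)
Lemma simple_node G (i j : 'I_n) : simple_flow_grid n G ->
  let v : vertex := (i.+1, j.+1) in
  [/\ [/\ G (rgt v, v) <-> ~ G (v, rgt v), G (v, lft v) <-> ~ G (lft v, v),
          G (blw v, v) <-> ~ G (v, blw v) & G (v, abv v) <-> ~ G (abv v, v)] &
      (`[< G (v, rgt v) >] + `[< G (abv v, v) >] =
       `[< G (v, blw v) >] + `[< G (lft v, v) >])%N].
Proof.
move=> [_ /(_ _ (internal_ord i j)) Gv] v.
have GE e : e.1 = v \/ e.2 = v -> G e = incident G v e.
  by move=> ev; apply/propext; split=> [|[]].
have edgeE (a b c d a' b' c' d' : nat) : (((a, b), (c, d)) = ((a', b'), (c', d')) :> edge) =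
    (a = a' /\ b = b' /\ c = c' /\ d = d').
  by apply/propext; split=> [[-> -> -> ->]|[-> [-> [-> ->]]]].
rewrite !{}GE; try by [left | right].
case: Gv => [->|->|[H [V [Hv Vv ->]]]]; last (case: Hv => ->; case: Vv => ->);
  rewrite /all_in /all_out /rightward /leftward /downward /upward /setU /= {}/v;
  rewrite /lft /rgt /abv /blw /= !edgeE; (split; first by split; lia);
  by do 4!case: asboolP => ?; lia.
Qed.

Lemma simple_grid_of G : simple_flow_grid n G ->
  exists r u, orientation r u /\ G = grid_of (flow r u).
Proof.
move=> sG; have [Gn _] := sG.
pose r i k := `[< G ((i.+1, k), (i.+1, k.+1)) >].
pose u k j := `[< G ((k, j.+1), (k.+1, j.+1)) >].
exists r, u; split.
  have lt_pred (i : 'I_n) : (n.-1 < n)%N by rewrite ltn_predL (leq_ltn_trans _ (ltn_ord i)).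
  split=> [i|j|i j]; last by case: (simple_node i j sG).
    (* No edge of [G] starts at a boundary vertex. This rules out an edge entering from column 0,
       and forces the outward edge at the last column, of index [n.-1]. *)
    apply/andP; split; first by apply/asboolPn => /Gn[/internalP[? [? []]]].
    have [[Gr _ _ _] _] := simple_node i (Ordinal (lt_pred i)) sG.
    apply/asboolP; apply: contrapT; move: Gr.
    rewrite /rgt /= prednK ?(leq_ltn_trans _ (ltn_ord i)) // => Gr /Gr/Gn[] /=.
    by rewrite /internal /= ltnn andbF.
  apply/andP; split; first by apply/asboolPn => /Gn[/internalP[? [? []]]].
  have [[_ _ Gr _] _] := simple_node (Ordinal (lt_pred j)) j sG.
  apply/asboolP; apply: contrapT; move: Gr.
  rewrite /blw /= prednK ?(leq_ltn_trans _ (ltn_ord j)) // => Gr /Gr/Gn[] /=.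
  by rewrite /internal /= ltnn.
have flowE e : flow r u e <-> G (edge_of e).
  case: e => -[i j] [h f]; have [[_ Gl _ Ga] _] := simple_node i j sG.
  case: h; case: f; rewrite /flow /edge_of.
  - by apply: iff_sym; exact: rwP (asboolP _).
  - by rewrite Gl; apply: iff_sym; exact: rwP (asboolPn _).
  - by apply: iff_sym; exact: rwP (asboolP _).
  - by rewrite Ga; apply: iff_sym; exact: rwP (asboolPn _).
apply/seteqP; split=> [[v w] Gvw|_ [e /flowE Ge <-] //].
have [/internalP[i [j /= vE]] wE] := Gn _ Gvw; subst v.
by case: wE Gvw => /= -> Gvw;
  [exists (i, j, (true, false)) | exists (i, j, (true, true))
  |exists (i, j, (false, false)) | exists (i, j, (false, true))] => //; apply/flowE.
Qed.

(** * The correspondence between ASMs and simple flow grids *)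

Variable R : realType.
Implicit Types (A : 'M[R]_n).

Definition path_sum A (e : arrow) : R :=
  let: (i, j, (h, f)) := e in
  if h then
    if f then \sum_(k < n | (k <= j)%N) A i k else \sum_(k < n | (j <= k)%N) A i k
  else
    if f then \sum_(k < n | (k <= i)%N) A k j else \sum_(k < n | (i <= k)%N) A k j.

Lemma path_sum_dotmx (e : arrow) : exists c, forall A, path_sum A e = dotmx c A.
Proof.
have sumE (I : finType) (P : pred I) (a b : I -> 'I_n) :
    exists c, forall A, \sum_(k | P k) A (a k) (b k) = dotmx c A.
  exists (\sum_(k | P k) delta_mx (a k) (b k)) => A; rewrite dotmx_suml.
  by apply: eq_bigr => k _; rewrite dotmx_delta.
case: e => -[i j] [[] []] /=;
  first [exact: (sumE _ _ (fun=> i) id) | exact: (sumE _ _ id (fun=> j))].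
Qed.

Lemma gmxE A : gmx A = [set edge_of e | e in [set e | path_sum A e = 1]].
Proof.
apply/seteqP; split=> [[v w] [i [j [/= vE]]]|_ [[[i j] [h f]] /= Ae <-]].
  subst v; case=> -[/= -> Aw];
  [exists (i, j, (true, true)) | exists (i, j, (true, false))
  |exists (i, j, (false, true)) | exists (i, j, (false, false))] => //.
exists i, j; split=> //=; move: Ae; case: h; case: f => Ae;
  [constructor 1|constructor 2|constructor 3|constructor 4] => //.
Qed.

(** Row indices are extended to natural numbers, as [orientation] expects, with the default [false]
    out of range. *)
Definition row_flow A (i k : nat) : bool := if insub i is Some i' then bsum (A i') k else false.
Definition col_flow A (k j : nat) : bool := if insub j is Some j' then bsum (A^~ j') k else false.

Lemma row_flowE A (i : 'I_n) k : row_flow A i k = bsum (A i) k.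
Proof. by rewrite /row_flow valK. Qed.

Lemma col_flowE A k (j : 'I_n) : col_flow A k j = bsum (A^~ j) k.
Proof. by rewrite /col_flow valK. Qed.

Definition flowmx A := flow (row_flow A) (col_flow A).

(** A sum from the right or bottom border is 1 minus the complementary sum from the opposite border,
    hence the negation of its boolean. *)
Lemma path_sumE A e : is_ASM A -> path_sum A e = (flowmx A e)%:R.
Proof.
move=> /is_ASM_alternating[ar ac].
have bsumN f (j : 'I_n) : alternating f -> \sum_(k < n | (j <= k)%N) f k = (~~ bsum f j)%:R.
  move=> fa; rewrite psum_geq psumE 1?ltnW //; case: (fa) => _ -> _.
  by case: bsum; rewrite ?subrr ?subr0.
case: e => -[i j] [h f]; rewrite /flowmx /flow !row_flowE !col_flowE.
by case: h; case: f => /=; rewrite ?bsumN -?psumE.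
Qed.

Lemma gmx_flow A : is_ASM A -> gmx A = grid_of (flowmx A).
Proof.
move=> aA; rewrite gmxE; congr image; apply/seteqP; split=> e /=; rewrite path_sumE //.
  by case: flowmx => // /eqP; rewrite eq_sym oner_eq0.
by move=> ->.
Qed.

Lemma gmx_edge A e : is_ASM A -> gmx A (edge_of e) <-> flowmx A e.
Proof. by move=> aA; rewrite gmx_flow // grid_ofE. Qed.

Lemma orientation_ASM A : is_ASM A -> orientation (row_flow A) (col_flow A).
Proof.
move=> /is_ASM_alternating[ar ac]; split=> [i|j|i j].
- by rewrite !row_flowE bsum0 bsumn.
- by rewrite !col_flowE bsum0 bsumn.
apply/eqP; rewrite !row_flowE !col_flowE -(eqr_nat R) !natrD.
have := alternating_diff j (ar i); have := alternating_diff i (ac j).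
by move=> /= ->; lra.
Qed.

Lemma gmx_simple A : is_ASM A -> simple_flow_grid n (gmx A).
Proof. by move=> aA; rewrite gmx_flow //; apply/grid_of_simple/orientation_ASM. Qed.

(** Differences of the row orientations define the entries of [A], and [or_node] says that the
    column orientations have the same differences. *)
Lemma simple_gmx G : simple_flow_grid n G ->
  exists2 A : 'M[R]_n, is_ASM A & gmx A = G.
Proof.
move=> /simple_grid_of[r [u [ru ->]]].
pose A : 'M[R]_n := \matrix_(i, j) ((r i j.+1)%:R - (r i j)%:R).
have Ar i j : A i j = (r i j.+1)%:R - (r i j)%:R by rewrite mxE.
have Au i j : A i j = (u i.+1 j)%:R - (u i j)%:R.
  have /(congr1 (fun k => k%:R : R)) := or_node ru i j.
  by rewrite Ar !natrD; lra.
have aA : is_ASM A by apply: asm_of_diff Ar Au (or_row ru) (or_col ru).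
exists A => //; rewrite gmx_flow //; congr grid_of; apply/funext => -[[i j] [h f]].
have /andP[/negbTE r0 _] := or_row ru i; have /andP[/negbTE u0 _] := or_col ru j.
have rE k : (k <= n)%N -> bsum (A i) k = r i k.
  exact: (@bsum_of_diff _ _ _ (r i)).
have uE k : (k <= n)%N -> bsum (A^~ j) k = u k j.
  by apply: (@bsum_of_diff _ _ _ (u^~ j)) => // l; exact: Au.
by rewrite /flowmx /flow !row_flowE !col_flowE !rE ?uE // ltnW.
Qed.

(** A single edge certifies a partial sum: the arrow on segment [k] of row [i] in the direction
    given by [A]. Value 1 forces [0 < k] and value 0 forces [k < n], so an entry for it to leave
    from exists. *)
Lemma row_arrow A (i : 'I_n) k : is_ASM A -> (k <= n)%N ->
  exists2 e, flowmx A e &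
    forall B, flowmx B e -> bsum (B i) k = bsum (A i) k.
Proof.
move=> /is_ASM_alternating[ar _] kn; case Ak: (bsum (A i) k).
  case: k kn Ak => [|k] kn Ak; first by rewrite bsum0 in Ak.
  by exists (i, Ordinal kn, (true, true)) => [|B]; rewrite /flowmx /flow row_flowE //.
have ltkn : (k < n)%N.
  by rewrite ltn_neqAle kn andbT; apply/eqP => kE; rewrite kE bsumn in Ak.
exists (i, Ordinal ltkn, (true, false)) => [|B]; rewrite /flowmx /flow row_flowE /= ?Ak //.
exact: negbTE.
Qed.

Lemma col_arrow A (j : 'I_n) k : is_ASM A -> (k <= n)%N ->
  exists2 e, flowmx A e &
    forall B, flowmx B e -> bsum (B^~ j) k = bsum (A^~ j) k.
Proof.
move=> /is_ASM_alternating[_ ac] kn; case Ak: (bsum (A^~ j) k).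
  case: k kn Ak => [|k] kn Ak; first by rewrite bsum0 in Ak.
  by exists (Ordinal kn, j, (false, true)) => [|B]; rewrite /flowmx /flow col_flowE //.
have ltkn : (k < n)%N.
  by rewrite ltn_neqAle kn andbT; apply/eqP => kE; rewrite kE bsumn in Ak.
exists (Ordinal ltkn, j, (false, false)) => [|B]; rewrite /flowmx /flow col_flowE /= ?Ak //.
exact: negbTE.
Qed.

(** The edges of [gmx A] certify all row partial sums of [A], and [B] has these edges too. *)
Lemma gmx_sub_eq A B : is_ASM A -> is_ASM B -> gmx A `<=` gmx B -> A = B.
Proof.
move=> aA aB AB; apply/matrixP => i j.
have bE k : (k <= n)%N -> bsum (A i) k = bsum (B i) k.
  move=> kn; have [e Ae Be] := row_arrow i aA kn; apply/esym/Be.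
  by apply/(gmx_edge e aB)/AB/(gmx_edge e aA).
have /is_ASM_alternating[arA _] := aA; have /is_ASM_alternating[arB _] := aB.
by rewrite (alternating_diff j (arA i)) (alternating_diff j (arB i)) !bE // ltnW.
Qed.

End Grids.

(** * Faces and elementary flow grids *)

Section FaceLattice.
Variables (R : realType) (n : nat).
Hypothesis n_gt0 : (0 < n)%N.
Implicit Types (A B : 'M[R]_n) (G : grid) (F : set 'M[R]_n).

Lemma face_of_grid_face G : faces (ASM_polytope R n) (face_of_grid R n G).
Proof.
have /choice[c cE] := @path_sum_dotmx n R.
(* The form is negated because [faces] asks for an upper bound, here 0. *)
pose w := - \sum_(e : arrow n | `[< ~ G (edge_of e) >]) c e.
have wE A : dotmx w A = - \sum_(e | `[< ~ G (edge_of e) >]) path_sum A e.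
  by rewrite dotmxNl dotmx_suml; congr (- _); apply: eq_bigr.
have ge0 A : is_ASM A -> forall e, 0 <= path_sum A e.
  by move=> aA e; rewrite path_sumE.
rewrite /face_of_grid.
rewrite (_ : [set A | _] = @is_ASM R n `&` [set A | dotmx w A = 0]).
  by apply: faces_conv => A aA; rewrite wE oppr_le0 sumr_ge0 // => e _; exact: ge0.
apply/seteqP; split=> A [aA AG]; split=> //.
  rewrite /= wE big1 ?oppr0 // => e /asboolP nGe; rewrite path_sumE //.
  by case Ae: flowmx => //; case: nGe; apply/AG/gmx_edge.
rewrite gmx_flow // => _ [e Ae <-]; apply: contrapT => nGe.
move/eqP: AG; rewrite wE oppr_eq0 psumr_eq0 => [/allP/(_ e)|e' _]; last exact: ge0.
by rewrite mem_index_enum asboolT //= path_sumE // Ae oner_eq0 => /(_ isT).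
Qed.

Lemma face_of_gridE A : is_ASM A -> face_of_grid R n (gmx A) = [set A].
Proof.
move=> aA; rewrite /face_of_grid (_ : [set B | _] = [set A]) ?conv_set1 //.
apply/seteqP; split=> [B [aB BA]|_ ->] /=; [exact: gmx_sub_eq | by split].
Qed.

(** By [face_of_gridE] some functional exposes [A] alone in the whole polytope, hence also in the
    smaller hull. *)
Lemma vertices_conv (S : set 'M[R]_n) : S `<=` @is_ASM R n -> vertices (conv S) = S.
Proof.
move=> Sasm; apply/seteqP; split; first exact: vertices_conv_sub.
move=> A SA; have aA := Sasm A SA.
have [c [b [cb AE]]] := face_of_grid_face (gmx A).
rewrite face_of_gridE // in AE.
have sub : conv S `<=` ASM_polytope R n by exact: conv_mono.
exists c, b; split=> [x /sub|]; first exact: cb.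
apply/seteqP; split=> [_ ->|x [/sub Px xb]]; last by rewrite AE.
have [_ Ab] : (ASM_polytope R n `&` [set x | dotmx c x = b]) A by rewrite -AE.
by split=> //; exact: subset_conv.
Qed.

Lemma gface_conv (S : set 'M[R]_n) : S `<=` @is_ASM R n ->
  gface (conv S) = \bigcup_(A in S) gmx A.
Proof. by move=> Sasm; rewrite /gface vertices_conv. Qed.

Lemma gface_sub F1 F2 : faces (ASM_polytope R n) F1 -> faces (ASM_polytope R n) F2 ->
  F1 `<=` F2 -> gface F1 `<=` gface F2.
Proof.
move=> /face_convE[c1 [b1 [_ ->]]] /face_convE[c2 [b2 [cb ->]]] sub.
rewrite !gface_conv; [|by move=> A []..] => x [A [aA Ab] Ax]; exists A => //.
split=> //; have /sub : conv (@is_ASM R n `&` [set x | dotmx c1 x = b1]) A by exact: subset_conv.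
by rewrite -conv_face // => -[].
Qed.

Lemma face_of_grid_sub G1 G2 : G1 `<=` G2 -> face_of_grid R n G1 `<=` face_of_grid R n G2.
Proof. by move=> sub; apply: conv_mono => A [aA AG]; split=> // x /AG/sub. Qed.

Lemma gface_elementary F : faces (ASM_polytope R n) F -> elementary_flow_grid n (gface F).
Proof.
move=> /face_convE[c [b [_ ->]]]; rewrite gface_conv; last by move=> A [].
exists (@gmx R n @` (@is_ASM R n `&` [set x | dotmx c x = b])); split.
  by move=> _ [A [aA _] <-]; exact: gmx_simple.
by rewrite bigcup_image.
Qed.

Lemma gfaceK F : faces (ASM_polytope R n) F -> face_of_grid R n (gface F) = F.
Proof.
move=> /face_convE[c [b [cb ->]]]; rewrite gface_conv; last by move=> A [].
set S := _ `&` _; rewrite /face_of_grid; congr conv; apply/seteqP; split; last first.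
  by move=> A SA; split; [case: SA | move=> x Ax; exists A].
move=> B [aB BS]; split=> //=.
(* The covering ASMs are indexed by all arrows: the one at [e] contains [e] if [B] does, and is any
   ASM of the face otherwise. *)
have chooseA (e : arrow n) : exists A, S A /\ (flowmx B e -> flowmx A e).
  have [Be|nBe] := boolP (flowmx B e).
    have /BS[A SA Ae] : gmx B (edge_of e) by apply/gmx_edge.
    by exists A; split=> // _; apply/(gmx_edge e) => //; case: SA.
  (* As [n] is positive, [B] has an edge, and an ASM of the face covering it serves as the
     default. *)
  have [e' Be' _] := row_arrow (Ordinal n_gt0) aB (leq0n n).
  have /BS[A SA _] : gmx B (edge_of e') by apply/gmx_edge.
  by exists A.
have /choice[A AS] := chooseA.
have [C [aC sumAE]] : exists C : 'I_#|{: arrow n}|.-1 -> 'M[R]_n,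
    (forall m, is_ASM (C m)) /\ \sum_e A e = B + \sum_m C m.
  apply: exchange => //.
  - rewrite !card_prod !card_bool card_ord; case: (n) n_gt0 => // m _; lia.
  - by move=> e; case: (AS e) => -[].
  - move=> i q qn; have [e Be eE] := row_arrow i aB qn.
    by exists e; apply: eE; case: (AS e) => _; apply.
  move=> j p pn; have [e Be eE] := col_arrow j aB pn.
  by exists e; apply: eE; case: (AS e) => _; apply.
apply/eqP; rewrite eq_le cb //=.
have := congr1 (dotmx c) sumAE; rewrite dotmxDr !dotmx_sumr.
rewrite (eq_bigr (fun=> b)) => [|e _]; last by case: (AS e) => -[].
have leC : \sum_m dotmx c (C m) <= \sum_(m < #|{: arrow n}|.-1) b.
  by apply: ler_sum => m _; exact: cb.
rewrite sumr_const => sumE; move: leC; rewrite sumr_const card_ord => leC.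
have cardK : #|{: arrow n}| = #|{: arrow n}|.-1.+1.
  by rewrite prednK // !card_prod !card_bool card_ord !muln_gt0 n_gt0.
by move: sumE; rewrite [in X in X = _]cardK mulrS; lra.
Qed.

(** Each simple grid in the union forming [G] is [gmx A] for an ASM [A], and this [A] is a vertex of
    the face. *)
Lemma face_of_gridK G : elementary_flow_grid n G -> gface (face_of_grid R n G) = G.
Proof.
move=> [S [sS ->]]; rewrite gface_conv; last by move=> A [].
apply/seteqP; split=> [x [A [_ AG] /AG]|x [H SH Hx]] //.
have [A aA AH] := simple_gmx R (sS _ SH).
by exists A; rewrite ?AH //; split=> // y; rewrite AH => Hy; exists H.
Qed.

Lemma gface_le F1 F2 : faces (ASM_polytope R n) F1 -> faces (ASM_polytope R n) F2 ->
  F1 `<=` F2 <-> gface F1 `<=` gface F2.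
Proof.
move=> F1P F2P; split; first exact: gface_sub.
by move=> /face_of_grid_sub; rewrite !gfaceK.
Qed.

End FaceLattice.

(** * The lattice structures and the isomorphism *)

Lemma elementary_flow_grid_lattice n : is_inclusion_lattice (elementary_flow_grid n).
Proof.
move=> A B [SA [sA ->]] [SB [sB ->]]; split.
  (* The meet collects the simple grids contained in both, since the intersection itself need not be
     elementary. *)
  exists (\bigcup_(H in [set H | simple_flow_grid n H /\
    H `<=` \bigcup_(K in SA) K /\ H `<=` \bigcup_(K in SB) K]) H); split.
  - by eexists; split; last by []; move=> H [].
  - by move=> x [H [_ [HA _]] /HA].
  - by move=> x [H [_ [_ HB]] /HB].
  move=> _ [S [sS ->]] SSA SSB x [H SH Hx]; exists H => //; split; first exact: sS.
  by split=> y Hy; [apply: SSA | apply: SSB]; exists H.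
exists (\bigcup_(H in SA `|` SB) H); split.
- by exists (SA `|` SB); split=> // H [/sA|/sB].
- by apply: bigcup_subset => H; left.
- by apply: bigcup_subset => H; right.
by move=> C _ subAC subBC x [H [SH|SH] Hx]; [apply: subAC | apply: subBC]; exists H.
Qed.

(** Preimages of the meet and join of [f A] and [f B] serve for [A] and [B], because [f] preserves
    and reflects inclusion. *)
Lemma inclusion_lattice_iso (T U : Type) (X : set (set T)) (Y : set (set U))
    (f : set T -> set U) :
  set_fun X Y f -> set_surj X Y f ->
  (forall A B, X A -> X B -> (A `<=` B <-> f A `<=` f B)) ->
  is_inclusion_lattice Y -> is_inclusion_lattice X.
Proof.
move=> fXY fsurj fle Ylat A B XA XB.
have [[M [YM MA MB Mmax]] [J [YJ AJ BJ Jmin]]] := Ylat _ _ (fXY _ XA) (fXY _ XB).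
have [M' XM' M'E] := fsurj _ YM; have [J' XJ' J'E] := fsurj _ YJ; subst M J.
split; [exists M' | exists J']; split=> //; try by apply/fle.
  by move=> C XC CA CB; apply/fle => //; apply: Mmax; [exact: fXY | exact/fle | exact/fle].
by move=> C XC CA CB; apply/fle => //; apply: Jmin; [exact: fXY | exact/fle | exact/fle].
Qed.

Theorem theorem4p3 (R : realType) (n : nat) (n_gt0 : (0 < n)%N) :
  (is_inclusion_lattice (faces (ASM_polytope R n)) /\
   is_inclusion_lattice (elementary_flow_grid n)) /\
  [/\ set_bij (faces (ASM_polytope R n)) (elementary_flow_grid n)
        (fun F => gface F),
      (forall F1 F2 : set 'M[R]_n,
         faces (ASM_polytope R n) F1 -> faces (ASM_polytope R n) F2 ->
         (F1 `<=` F2 <-> gface F1 `<=` gface F2)),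
      (forall F : set 'M[R]_n, faces (ASM_polytope R n) F ->
         face_of_grid R n (gface F) = F),
      (forall G : grid, elementary_flow_grid n G ->
         faces (ASM_polytope R n) (face_of_grid R n G) /\
         gface (face_of_grid R n G) = G)
    & [/\ faces (ASM_polytope R n) set0,
          elementary_flow_grid n set0
        & gface (set0 : set 'M[R]_n) = set0]].
Proof.
have gfun : set_fun (faces (ASM_polytope R n)) (elementary_flow_grid n) (@gface R n).
  by move=> F; exact: gface_elementary.
have gsurj : set_surj (faces (ASM_polytope R n)) (elementary_flow_grid n) (@gface R n).
  move=> G eG; exists (face_of_grid R n G); first exact: face_of_grid_face.
  exact: face_of_gridK.
have gle := @gface_le R n n_gt0.
have elat := @elementary_flow_grid_lattice n.
split; first by split=> //; exact: inclusion_lattice_iso gfun gsurj gle elat.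
split=> //.
- split=> // F1 F2; rewrite !inE => F1P F2P gE.
  by rewrite -(gfaceK n_gt0 F1P) gE gfaceK.
- by move=> F; exact: gfaceK.
- by move=> G eG; split; [exact: face_of_grid_face | exact: face_of_gridK].
split.
- exists 0, 1; split=> [x _|]; first by rewrite dotmx0l ler01.
  apply/seteqP; split=> // x [_ /=]; rewrite dotmx0l => /eqP.
  by rewrite eq_sym oner_eq0.
- by exists set0; rewrite bigcup_set0.
by rewrite /gface vertices_set0 bigcup_set0.
Qed.
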